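(* Consider the natural action of $G={\rm SO}(V)\otimes{\rm SO}(V)$ on $W=V\otimes V$. If $p\neq 2$ then the generic stabilizer of a vector in $W$ is a finite nontrivial elementary abelian $2$-group.
   Context: $V$ is a finite-dimensional vector space over an algebraically closed field $K$ of characteristic $p\geqslant 0$, and ${\rm SO}(V)$ is the special orthogonal group of a non-degenerate quadratic form on $V$. ${\rm SO}(V)\otimes{\rm SO}(V)$ denotes the image of ${\rm SO}(V)\times{\rm SO}(V)$ in ${\rm GL}(V\otimes V)$, acting by $(g_1,g_2)(v_1\otimes v_2)=g_1v_1\otimes g_2v_2$. The generic stabilizer of a vector in $W$ is said to have a given property if there is a non-empty open subvariety $W_0$ of $W$ such that the stabilizer $G_w$ has that property for all $w\in W_0$.
   Formalization: The formal statement assumes dim V ≥ 3; for dim V ≤ 2 the generic stabilizer in SO(V)⊗SO(V) is trivial, so the claim ''nontrivial'' is false there. *)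

(* Defs.v *)
From HB Require Import structures.
From mathcomp Require Import all_boot all_order all_algebra.
From mathcomp Require Import all_fingroup all_solvable.
From mathcomp Require Import mpoly.

Set Implicit Arguments.
Unset Strict Implicit.
Unset Printing Implicit Defensive.

Import GRing.Theory.
Local Open Scope ring_scope.

Section QuadraticForms.
Variables (K : fieldType) (V : vectType K).

Definition polar (Q : V -> K) (u v : V) : K := Q (u + v) - Q u - Q v.

Record quadratic_form (Q : V -> K) : Prop := QuadraticForm {
  quadraticZ : forall (a : K) (v : V), Q (a *: v) = a ^+ 2 * Q v;
  polar_linearl : forall v : V, scalar (polar Q ^~ v);
  polar_linearr : forall u : V, scalar (polar Q u)
}.

(* This is the notion of non-degeneracy for quadratic forms in characteristic
   different from 2. *)
Definition nondegenerate_quadratic (Q : V -> K) : Prop :=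
  forall v : V, (forall u : V, polar Q u v = 0) -> v = 0.

Definition lfun_det (g : 'End(V)) : K :=
  \det (passmx.mxof (vbasis {:V}) (vbasis {:V}) g).

(* SO(V) in characteristic different from 2; in characteristic 2 every
   isometry has determinant 1, and SO(V) has to be defined differently. *)
Definition special_orthogonal (Q : V -> K) (g : 'End(V)) : Prop :=
  (forall v : V, Q (g v) = Q v) /\ lfun_det g = 1.

End QuadraticForms.

(* The universal property of W = U (x) V, with t u v = u (x) v. *)
Definition is_tensor_product (K : fieldType) (U V W : vectType K)
    (t : {bilinear U -> V -> W}) : Prop :=
  forall (X : vectType K) (b : {bilinear U -> V -> X}),
    exists! f : 'Hom(W, X), forall u v, f (t u v) = b u v.

(* Tensor products exist: the space of matrices, with the outer product. *)
Section TensorProductExists.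
Variables (K : fieldType) (U V : vectType K).
Local Notation m := (\dim {:U}).
Local Notation n := (\dim {:V}).
Local Notation eU := (vbasis {:U}).
Local Notation eV := (vbasis {:V}).

Definition outer (u : U) (v : V) : 'M[K]_(m, n) :=
  \matrix_(i, j) (coord eU i u * coord eV j v).

Lemma outer_is_bilinear : bilinear_for
  (GRing.Scale.Law.clone _ _ *:%R _) (GRing.Scale.Law.clone _ _ *:%R _) outer.
Proof.
split=> [v|u] a x y /=; apply/matrixP=> i j; rewrite !mxE linearP /=.
  by rewrite mulrDl mulrA.
by rewrite mulrDr mulrCA.
Qed.

HB.instance Definition _ := bilinear_isBilinear.Build K U V 'M[K]_(m, n)
  _ _ outer outer_is_bilinear.

Lemma outer_tensor_product :
  is_tensor_product (outer : {bilinear U -> V -> 'M[K]_(m, n)}).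
Proof.
move=> X b.
pose F (M : 'M[K]_(m, n)) : X := \sum_i \sum_j M i j *: b eU`_i eV`_j.
have Flin : linear F.
  move=> a M N; rewrite /F scaler_sumr -big_split /=; apply: eq_bigr => i _.
  rewrite scaler_sumr -big_split /=; apply: eq_bigr => j _.
  by rewrite !mxE scalerDl scalerA.
have bE u v : b u v = \sum_i \sum_j (coord eU i u * coord eV j v) *:
    b eU`_i eV`_j.
  rewrite {1}(coord_vbasis (memvf u)) linear_sumlz; apply: eq_bigr => i _.
  rewrite linearZl_LR /= {1}(coord_vbasis (memvf v)) linear_sumr scaler_sumr.
  by apply: eq_bigr => j _; rewrite linearZr_LR /= scalerA.
have basis_coord (Y : vectType K) (i k : 'I_(\dim {:Y})) :
    coord (vbasis {:Y}) k (vbasis {:Y})`_i = (k == i)%:R.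
  by rewrite coord_free ?(basis_free (vbasisP _)) // eq_sym.
pose FL := GRing.isLinear.Build K 'M[K]_(m, n) X *:%R F Flin.
pose Fl : {linear 'M[K]_(m, n) -> X} := HB.pack F FL.
exists (linfun Fl); split.
  move=> u v; rewrite lfunE /= /F bE.
  by apply: eq_bigr => i _; apply: eq_bigr => j _; rewrite mxE.
move=> g gE; apply/lfunP=> M; rewrite lfunE /= /F {2}(matrix_sum_delta M).
rewrite linear_sum; apply: eq_bigr => i _; rewrite linear_sum.
apply: eq_bigr => j _; rewrite linearZ /= -gE; congr (_ *: g _).
apply/matrixP=> k l; rewrite !mxE !basis_coord.
by case: (k == i); case: (l == j); rewrite ?mul0r ?mul1r ?mulr0.
Qed.

End TensorProductExists.

(* The image of SO(V) x SO(V) in GL(V (x) V); the endomorphisms h obtained in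
   this way are automatically invertible. *)
Definition SO_tensor_SO (K : fieldType) (V W : vectType K) (Q : V -> K)
    (t : {bilinear V -> V -> W}) (h : 'End(W)) : Prop :=
  exists g1 g2 : 'End(V),
    [/\ special_orthogonal Q g1, special_orthogonal Q g2
      & forall v1 v2 : V, h (t v1 v2) = t (g1 v1) (g2 v2)].

Section GenericStabilizers.
Variables (K : fieldType) (W : vectType K).

Definition poly_eval (f : {mpoly K[\dim {:W}]}) (w : W) : K :=
  f.@[fun i => coord (vbasis {:W}) i w].

Definition zariski_open (W0 : W -> Prop) : Prop :=
  exists S : {mpoly K[\dim {:W}]} -> Prop,
    forall w, W0 w <-> (exists2 f, S f & poly_eval f w != 0).

Definition stabilizer (G : 'End(W) -> Prop) (w : W) (h : 'End(W)) : Prop :=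
  G h /\ h w = w.

Definition generic_stabilizer (G : 'End(W) -> Prop)
    (P : ('End(W) -> Prop) -> Prop) : Prop :=
  exists W0 : W -> Prop,
    [/\ zariski_open W0, exists w, W0 w & forall w, W0 w -> P (stabilizer G w)].

End GenericStabilizers.

(* H, a set of endomorphisms of W, is a group under composition which is
   isomorphic to a finite nontrivial elementary abelian p-group E. *)
Definition finite_nontrivial_elementary_abelian (p : nat) (K : fieldType)
    (W : vectType K) (H : 'End(W) -> Prop) : Prop :=
  exists (gT : finGroupType) (E : {group gT}) (f : gT -> 'End(W)),
    [/\ {in E &, injective f},
        forall h, H h <-> (exists2 x, x \in E & h = f x),
        {in E &, forall x y, f (x * y)%g = (f x \o f y)%VF},
        (p.-abelem E)%g & E :!=: 1%g].

(* Main.v *)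
From HB Require Import structures.
Require Import Defs.
From mathcomp Require Import all_boot all_order all_algebra.
From mathcomp Require Import all_fingroup all_solvable.
From mathcomp Require Import mpoly.

Set Implicit Arguments.
Unset Strict Implicit.
Unset Printing Implicit Defensive.

Import GRing.Theory.
Local Open Scope ring_scope.

(** The idea is to write a generic tensor in a basis that is adapted to the
form, as one does with a singular value decomposition.

Fix coordinates on V and let B be the Gram matrix of the polar form.  A tensor
w becomes a square matrix A, a pair of isometries becomes a pair of matrices
G1, G2 with G B G^T = B, and (G1, G2) sends A to G1^T A G2.  Suppose that A is
invertible and that S = B A B A^T has n distinct eigenvalues.  As S is
self-adjoint for the form, its eigenvectors form an orthogonal basis U of V,
and then A = U^T U' where the basis U' is orthogonal as well: in other words,
w is the sum of the u_i (x) u'_i ([orthogonal_normal_form]).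

If (g1, g2) fixes w, then the matrix E of g1 in the basis U commutes with the
product of the Gram matrices of U and U'.  This product is diagonal, and its
entries are the eigenvalues of S, which are distinct; so E is diagonal.  As g1
is an isometry, the entries of E are signs, and g2 is given by the same signs
in the basis U' ([stabilizer_normal_form]).

The stabilizer is therefore the image of the group of sign vectors of
determinant 1, which is an elementary abelian 2-group.  The kernel of the map
to GL(W) is not trivial in even dimension, but it has a complement, which is
the required group ([elementary_abelian_image]).  Since n > 2, some sign vector
of determinant 1 takes both signs, say -1 at i and 1 at j; it negates
u_i (x) u'_j, so the stabilizer is not trivial.

The condition on A is open and must be given by a polynomial in the entries of
A.  The matrix S has n distinct eigenvalues if and only if the determinant of
the traces of S^(i+j), which is the discriminant of its characteristic
polynomial, does not vanish ([trace_disc_diagonalizable]).  Some A satisfies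
it: take for w a combination of the u_i (x) u_i, where U is an orthogonal basis,
with coefficients that make the eigenvalues distinct
([exists_generic_tensor]). *)

(** * A polynomial criterion for distinct eigenvalues *)

(** This is the Gram determinant of the trace form on the powers of S.  Unlike
the resultant of the characteristic polynomial and its derivative, whose
degree may drop when p divides n, it obviously commutes with ring morphisms. *)
Definition trace_disc (R : comPzRingType) (n : nat) (S : 'M[R]_n) : R :=
  \det (\matrix_(i < n, j < n) \tr (S ^+ (i + j))).

Lemma trace_disc_map (R R' : comPzRingType) (f : {rmorphism R -> R'})
    (n : nat) (S : 'M[R]_n) :
  trace_disc (map_mx f S) = f (trace_disc S).
Proof.
have mapX k : map_mx f (S ^+ k) = map_mx f S ^+ k.
  by elim: k => [|k IHk]; rewrite ?map_mx1 // !exprS map_mxM IHk.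
rewrite -det_map_mx; congr (\det _); apply/matrixP => i j.
by rewrite !mxE -trace_map_mx mapX.
Qed.

Section Diagonalization.
Variables (F : fieldType) (n : nat).
Implicit Types (S P N : 'M[F]_n) (d : 'rV[F]_n).

(** Write N = C R with C of full column rank and R of full row rank.  Then
C R C R = 0 forces R C = 0, and N has the same trace as R C. *)
Lemma mxtrace_square_zero N : N *m N = 0 -> \tr N = 0.
Proof.
move=> NN; rewrite -[N in \tr N]mulmx_base mxtrace_mulC.
suff -> : row_base N *m col_base N = 0 by rewrite mxtrace0.
apply: (row_free_inj (row_base_free N)).
apply: (row_full_inj (col_base_full N)).
by rewrite mul0mx mulmx0 -mulmxA mulmx_base mulmxA mulmx_base.
Qed.

(** The trace of S^(i+j) is the sum of the l^i l^j over the eigenvalues l, so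
the matrix of traces is a Vandermonde matrix times its transpose. *)
Lemma trace_disc_diag S P d : P \in unitmx -> P *m S = diag_mx d *m P ->
  trace_disc S = \det (Vandermonde n d) ^+ 2.
Proof.
move=> Pu PS.
have PSk k : P *m S ^+ k = diag_mx (\row_i d 0 i ^+ k) *m P.
  elim: k => [|k IHk].
    rewrite (_ : \row_i _ = const_mx 1) ?diag_const_mx ?mul1mx ?mulmx1 //.
    by apply/rowP => i; rewrite !mxE.
  rewrite exprS -mulmxE mulmxA PS -mulmxA IHk mulmxA; congr (_ *m _).
  by rewrite mulmx_diag; congr diag_mx; apply/rowP => i; rewrite !mxE exprS.
rewrite expr2 -[X in _ * X]det_tr -det_mulmx; congr (\det _).
apply/matrixP => i j; rewrite !mxE.
rewrite -[_ ^+ _](mulKmx Pu) mxtrace_mulC PSk mulmxK // mxtrace_diag.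
by apply: eq_bigr => k _; rewrite !mxE exprD.
Qed.

Lemma trace_disc_neq0 S P d : P \in unitmx -> P *m S = diag_mx d *m P ->
  trace_disc S != 0 <-> injective (d 0).
Proof.
move=> Pu /(trace_disc_diag Pu) ->; rewrite expf_eq0 /= det_Vandermonde.
split=> [prod_neq0 i j dij | dinj].
  apply/val_inj; case: (ltngtP i j) => // ltij; case/negP: prod_neq0;
    apply/prodf_eq0.
  - exists i => //; apply/prodf_eq0; exists j => //.
    by rewrite dij subrr.
  - exists j => //; apply/prodf_eq0; exists i => //.
    by rewrite dij subrr.
apply/prodf_neq0 => i _; apply/prodf_neq0 => j ltij.
by rewrite subr_eq0 (inj_eq dinj); apply: contraTneq ltij => ->; rewrite ltnn.
Qed.

End Diagonalization.

(** If r(S) squares to zero, then so does each r(S) S^j, which therefore has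
trace 0: the coefficients of r are in the kernel of the matrix of traces. *)
Lemma trace_disc_nilpotent (F : fieldType) (n : nat) (S : 'M[F]_n.+1)
    (r : {poly F}) : r != 0 -> (size r <= n.+1)%N ->
  horner_mx S (r ^+ 2) = 0 -> trace_disc S = 0.
Proof.
move=> r_neq0 size_r r2_0; apply/eqP/det0P.
exists (\row_j r`_j).
  apply: contra_neq r_neq0 => /rowP r0; apply/polyP => i; rewrite coef0.
  case: (ltnP i n.+1) => [lti|lei].
    by have := r0 (Ordinal lti); rewrite !mxE.
  by rewrite nth_default // (leq_trans size_r).
apply/rowP => j; rewrite !mxE.
transitivity (\tr (horner_mx S (r * 'X^j))).
  rewrite rmorphM rmorphXn /= horner_mx_X.
  have -> : horner_mx S r = \sum_(i < n.+1) r`_i *: S ^+ i.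
    rewrite -[in LHS](coefK r) poly_def.
    rewrite (big_ord_widen n.+1 (fun i => r`_i *: 'X^i)) // big_mkcond /=.
    rewrite rmorph_sum; apply: eq_bigr => i _ /=.
    case: ltnP => [_|lei]; last by rewrite nth_default // scale0r rmorph0.
    by rewrite linearZ /= rmorphXn /= horner_mx_X.
  rewrite mulr_suml raddf_sum; apply: eq_bigr => i _ /=.
  by rewrite !mxE -scalerAl linearZ /= -exprD.
apply: mxtrace_square_zero; rewrite mulmxE -rmorphM.
by rewrite -expr2 exprMn rmorphM /= r2_0 mul0r.
Qed.

Lemma not_uniq_perm (T : eqType) (s : seq T) :
  ~~ uniq s -> exists x s', perm_eq s [:: x, x & s'].
Proof.
elim: s => //= a s IHs; rewrite negb_and negbK.
case: (boolP (a \in s)) => [a_s _|_ /= /IHs[x [s' sE]]].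
  by exists a, (rem a s); rewrite perm_cons perm_to_rem.
exists x, (a :: s'); rewrite perm_sym.
by rewrite (perm_catCA [:: x; x] [:: a] s') /= perm_cons perm_sym.
Qed.

(** A double root x of the characteristic polynomial chi would make
r = chi / (X - x) nonzero with r(S)^2 = 0 by Cayley-Hamilton, since chi
divides r^2. *)
Lemma trace_disc_diagonalizable (K : closedFieldType) (n : nat) (S : 'M[K]_n) :
  trace_disc S != 0 ->
  exists P d, [/\ P \in unitmx, P *m S = diag_mx d *m P & injective (d 0)].
Proof.
case: n => [|n] in S *.
  move=> _; exists 1%:M, 0; split; rewrite ?unitmx1 //; last by case.
  by rewrite [LHS]flatmx0 [RHS]flatmx0.
move=> disc; have [rs rsE] := closed_field_poly_normal (char_poly S).
rewrite (monicP (char_poly_monic S)) scale1r in rsE.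
have Urs : uniq rs.
  apply: contraR disc => /not_uniq_perm[x [s rs_s]]; apply/eqP.
  move: rsE; rewrite (perm_big _ rs_s) 2!big_cons /=.
  set q := \prod_(z <- s) _ => chiE.
  have r_neq0 : ('X - x%:P) * q != 0.
    apply: contraTneq (char_poly_monic S) => r0.
    by rewrite chiE r0 mulr0 monicE lead_coef0 eq_sym oner_eq0.
  apply: (trace_disc_nilpotent r_neq0).
    have := size_char_poly S.
    by rewrite chiE size_mul ?polyXsubC_eq0 ?size_XsubC // add2n => - [->].
  rewrite expr2 mulrACA -expr2 mulrA.
  rewrite [X in horner_mx _ X](_ : _ = char_poly S * q); last first.
    by rewrite chiE; rewrite expr2 -!mulrA.
  by rewrite rmorphM /= Cayley_Hamilton mul0r.
have [P Pu /similar_diagPex[d Pd]] : diagonalizable S.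
  apply/diagonalizableP; exists rs => //.
  by rewrite -rsE mxminpoly_dvd_char.
have PS := similarPp (stablemx_unit _ Pu) Pd.
by exists P, d; split=> //; apply/(trace_disc_neq0 Pu PS).
Qed.

(** * Sign matrices and the stabilizer of a tensor in normal form *)

Lemma comm_diag_mx (F : fieldType) (n : nat) (E : 'M[F]_n) (d : 'rV[F]_n) :
  injective (d 0) -> E *m diag_mx d = diag_mx d *m E ->
  exists e, E = diag_mx e.
Proof.
move=> dinj /matrixP Ed; exists (\row_i E i i); apply/matrixP => i j.
rewrite !mxE; case: eqVneq => [->|neq_ij] /=; first by rewrite mulr1n.
move/eqP: (Ed i j); rewrite mul_mx_diag mul_diag_mx !mxE.
rewrite mulrC -subr_eq0 -mulrBl.
by rewrite mulf_eq0 subr_eq0 (inj_eq dinj) eq_sym (negPf neq_ij) => /eqP.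
Qed.

Section OrthogonalForms.
Variables (F : fieldType) (n : nat).
Implicit Types (B A U V G : 'M[F]_n) (c d : 'rV[F]_n) (x y : 'rV[bool]_n).

(** Booleans stand for signs because rows of booleans form a finite group, whose
addition is the pointwise exclusive or. *)
Definition signmx x : 'M[F]_n := diag_mx (\row_i (-1) ^+ (x 0 i)).

(** The endomorphism that multiplies the i-th row vector of the basis U by the
i-th sign of x. *)
Definition sign_in U x : 'M[F]_n := invmx U *m signmx x *m U.

Lemma signmxD x y : signmx (x + y) = signmx x *m signmx y.
Proof.
rewrite mulmx_diag; congr diag_mx; apply/rowP => i.
by rewrite !mxE -signr_addb.
Qed.

Lemma signmx0 : signmx 0 = 1%:M.
Proof.
rewrite -diag_const_mx; congr diag_mx; apply/rowP => i.
by rewrite !mxE expr0.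
Qed.

Lemma signmxK x : signmx x *m signmx x = 1%:M.
Proof.
rewrite -signmxD -signmx0; congr signmx; apply/rowP => i.
by rewrite !mxE; case: (x 0 i).
Qed.

Lemma tr_signmx x : (signmx x)^T = signmx x.
Proof. exact: tr_diag_mx. Qed.

Lemma sign_inD U x y : U \in unitmx ->
  sign_in U (x + y) = sign_in U x *m sign_in U y.
Proof. by move=> Uu; rewrite /sign_in signmxD !mulmxA mulmxK. Qed.

Lemma sign_in0 U : U \in unitmx -> sign_in U 0 = 1%:M.
Proof. by move=> Uu; rewrite /sign_in signmx0 mulmx1 mulVmx. Qed.

Lemma det_sign_in U x : U \in unitmx -> \det (sign_in U x) = \det (signmx x).
Proof.
move=> Uu; rewrite !det_mulmx mulrAC -det_mulmx mulVmx //.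
by rewrite det1 mul1r.
Qed.

Lemma mulmx_sign_in U x : U \in unitmx -> U *m sign_in U x = signmx x *m U.
Proof. by move=> Uu; rewrite !mulmxA mulmxV // mul1mx. Qed.

(** The rows of U are a basis of the space of rows: E is the matrix of G, and C
is the Gram matrix, in this basis. *)
Lemma isometry_conj B C U G E : U \in unitmx -> U *m B *m U^T = C ->
  U *m G = E *m U -> G *m B *m G^T = B <-> E *m C *m E^T = C.
Proof.
move=> Uu <- UG; have UTu : U^T \in unitmx by rewrite unitmx_tr.
have -> : E *m (U *m B *m U^T) *m E^T = U *m (G *m B *m G^T) *m U^T.
  by rewrite !mulmxA UG -!mulmxA -!trmx_mul UG.
split=> [-> //|]; move/(can_inj (mulmxK UTu)); exact: (can_inj (mulKmx Uu)).
Qed.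

Lemma stabilizer_conj U V G1 G2 E1 E2 : U \in unitmx -> V \in unitmx ->
  U *m G1 = E1 *m U -> V *m G2 = E2 *m V ->
  G1^T *m (U^T *m V) *m G2 = U^T *m V <-> E1^T *m E2 = 1%:M.
Proof.
move=> Uu Vu UG VG; have UTu : U^T \in unitmx by rewrite unitmx_tr.
have -> : G1^T *m (U^T *m V) *m G2 = U^T *m (E1^T *m E2) *m V.
  by rewrite !mulmxA -!trmx_mul UG -!mulmxA VG.
split=> [|->]; last by rewrite mulmx1.
rewrite -[in RHS](mulmx1 U^T).
by move/(can_inj (mulmxK Vu)); exact: (can_inj (mulKmx UTu)).
Qed.

Lemma sign_in_act U V x (M : 'M[F]_n) : U \in unitmx -> V \in unitmx ->
  (sign_in U x)^T *m (U^T *m M *m V) *m sign_in V x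
    = U^T *m (signmx x *m M *m signmx x) *m V.
Proof.
move=> Uu Vu; rewrite -(mulmxA _ _ (sign_in V x)).
rewrite -[X in _ *m X]mulmxA mulmx_sign_in // !mulmxA.
by rewrite -trmx_mul mulmx_sign_in // trmx_mul tr_signmx.
Qed.

Lemma sign_in_isometry B U c x : U \in unitmx -> U *m B *m U^T = diag_mx c ->
  sign_in U x *m B *m (sign_in U x)^T = B.
Proof.
move=> Uu UB; apply/(isometry_conj Uu UB (mulmx_sign_in x Uu)).
by rewrite tr_signmx diag_mxC -mulmxA signmxK mulmx1.
Qed.

Lemma sign_in_stabilizes U V x : U \in unitmx -> V \in unitmx ->
  (sign_in U x)^T *m (U^T *m V) *m sign_in V x = U^T *m V.
Proof.
move=> Uu Vu; have UG := mulmx_sign_in x Uu; have VG := mulmx_sign_in x Vu.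
by apply/(stabilizer_conj Uu Vu UG VG); rewrite tr_signmx signmxK.
Qed.

(** Let E1 and E2 be the matrices of G1 and G2 in the bases U and V.  They
satisfy E1^T E2 = 1, E1 C E1^T = C and E2 D E2^T = D, where C and D are the
diagonal Gram matrices.  Hence E1 C D = C E2 D = C D E1, and E1 is diagonal
because C D has distinct entries. *)
Lemma stabilizer_normal_form B U V c d G1 G2 :
  B \in unitmx -> U \in unitmx -> V \in unitmx ->
  U *m B *m U^T = diag_mx c -> V *m B *m V^T = diag_mx d ->
  injective (fun i => c 0 i * d 0 i) ->
  G1 *m B *m G1^T = B -> G2 *m B *m G2^T = B ->
  G1^T *m (U^T *m V) *m G2 = U^T *m V ->
  exists x, G1 = sign_in U x /\ G2 = sign_in V x.
Proof.
move=> Bu Uu Vu UB VB cdinj G1B G2B G12.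
pose E1 := U *m G1 *m invmx U; pose E2 := V *m G2 *m invmx V.
have EU : U *m G1 = E1 *m U by rewrite mulmxKV.
have EV : V *m G2 = E2 *m V by rewrite mulmxKV.
have/(stabilizer_conj Uu Vu EU EV) E12 := G12.
have/(isometry_conj Uu UB EU) cE := G1B.
have/(isometry_conj Vu VB EV) dE := G2B.
have E21 : E2^T *m E1 = 1%:M by rewrite -[E1]trmxK -trmx_mul E12 trmx1.
pose cd := \row_i (c 0 i * d 0 i).
have cdE : diag_mx cd = diag_mx c *m diag_mx d by rewrite mulmx_diag.
have [e eE] : exists e, E1 = diag_mx e.
  apply: (@comm_diag_mx _ _ _ cd); first by move=> i j; rewrite !mxE => /cdinj.
  have CE : E1 *m diag_mx c = diag_mx c *m E2.
    by rewrite -{2}cE -mulmxA E12 mulmx1.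
  have DE : E2 *m diag_mx d = diag_mx d *m E1.
    by rewrite -{2}dE -mulmxA E21 mulmx1.
  by rewrite cdE mulmxA CE -mulmxA DE mulmxA.
have c_neq0 i : c 0 i != 0.
  have : diag_mx c \in unitmx by rewrite -UB !unitmx_mul unitmx_tr Uu Bu.
  by rewrite unitmxE det_diag unitfE => /prodf_neq0/(_ i isT).
have ee i : e 0 i ^+ 2 == 1.
  move/matrixP/(_ i i): cE; rewrite eE tr_diag_mx !mulmx_diag !mxE eqxx !mulr1n.
  rewrite mulrAC -expr2 -[X in _ = X]mul1r => /(mulIf (c_neq0 i)) ->.
  exact: eqxx.
have [x xE] : exists x, E1 = signmx x.
  exists (\row_i (e 0 i == -1)); rewrite eE; congr diag_mx; apply/rowP => i.
  have:= ee i; rewrite !mxE -[X in _ == X](expr1n _ 2) eqf_sqr.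
  by case: (eqVneq (e 0 i) (-1)) => [->|_]; rewrite ?expr1 // orbF => /eqP.
have E2E : E2 = signmx x.
  by rewrite -[E2]mul1mx -(signmxK x) -mulmxA -{2}(tr_signmx x) -xE E12 mulmx1.
exists x; split.
  by apply: (can_inj (mulKmx Uu)); rewrite mulmx_sign_in // -xE.
by apply: (can_inj (mulKmx Vu)); rewrite mulmx_sign_in // -E2E.
Qed.

End OrthogonalForms.

(** The rows of U are eigenvectors of S = B A B A^T, and V is forced by
A = U^T V.  For the Gram matrices C of U and D of V, the product C D is the
diagonal matrix of the eigenvalues of S.  As C and D are symmetric, D C is the
same matrix; so C and D commute with it, and they are diagonal. *)
Lemma orthogonal_normal_form (K : closedFieldType) (n : nat) (B A : 'M[K]_n) :
  B^T = B -> A \in unitmx ->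
  trace_disc (B *m A *m B *m A^T) != 0 ->
  exists U V c d,
    [/\ [/\ U \in unitmx, V \in unitmx & A = U^T *m V],
        U *m B *m U^T = diag_mx c, V *m B *m V^T = diag_mx d &
        injective (fun i => c 0 i * d 0 i)].
Proof.
move=> B_sym Au /trace_disc_diagonalizable[U [l [Uu US linj]]].
have UTu : U^T \in unitmx by rewrite unitmx_tr.
have [V Vu AE] : exists2 V, V \in unitmx & A = U^T *m V.
  exists (invmx U^T *m A); last by rewrite mulKVmx.
  by rewrite unitmx_mul unitmx_inv UTu.
have CD : (U *m B *m U^T) *m (V *m B *m V^T) = diag_mx l.
  apply: (can_inj (mulmxK Uu)); rewrite -US AE trmx_mul trmxK.
  by rewrite !mulmxA.
set C := U *m B *m U^T in CD; set D := V *m B *m V^T in CD.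
have C_sym : C^T = C by rewrite !trmx_mul trmxK B_sym mulmxA.
have D_sym : D^T = D by rewrite !trmx_mul trmxK B_sym mulmxA.
have DC : D *m C = diag_mx l.
  by rewrite -[D]D_sym -[C]C_sym -trmx_mul CD tr_diag_mx.
have [c cE] : exists c, C = diag_mx c.
  by apply: (comm_diag_mx linj); rewrite -{1}DC -CD mulmxA.
have [d dE] : exists d, D = diag_mx d.
  by apply: (comm_diag_mx linj); rewrite -{1}CD -DC mulmxA.
exists U, V, c, d; split=> // i j cd; apply: linj.
have /matrixP lE : diag_mx l = diag_mx (\row_i (c 0 i * d 0 i)).
  by rewrite -CD cE dE mulmx_diag.
by have := lE i i; have := lE j j; rewrite !mxE !eqxx !mulr1n cd => -> ->.
Qed.


(** * Existence of generic tensors *)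

Lemma delta_form_mx (R : pzRingType) (m n : nat) (X : 'M[R]_(m, n)) i j :
  ((delta_mx 0 i : 'rV_m) *m X *m (delta_mx 0 j : 'rV_n)^T) 0 0 = X i j.
Proof. by rewrite -rowE trmx_delta -colE !mxE. Qed.

Section CongruenceDiagonalization.
Variable F : fieldType.
Hypothesis F2 : 2%:R != 0 :> F.

(** By polarization, a form that vanishes on the sums e_i + e_j, including
e_i + e_i, has no nonzero Gram entry. *)
Lemma exists_anisotropic (n : nat) (B : 'M[F]_n) : B^T = B -> B != 0 ->
  exists v : 'rV_n, (v *m B *m v^T) 0 0 != 0.
Proof.
pose q (v : 'rV_n) := (v *m B *m v^T) 0 0.
move=> B_sym.
have [ij qij _|q0] := pickP (fun ij => q ('e_ij.1 + 'e_ij.2) != 0).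
  by exists ('e_ij.1 + 'e_ij.2).
case/eqP; apply/matrixP => i j; rewrite mxE.
have qe k l : B k k + B k l + (B k l + B l l) = 0.
  have addE (X Y : 'M[F]_1) : (X + Y) 0 0 = X 0 0 + Y 0 0 by rewrite mxE.
  have := q0 (k, l); rewrite /q /= => /negbFE/eqP <-.
  rewrite linearD /= mulmxDl mulmxDr !mulmxDl !addE !delta_form_mx.
  by rewrite -{2}B_sym mxE.
have B0 k : B k k = 0.
  have := qe k k.
  rewrite -!mulr2n -[X in X = _]mulr_natl -[X in _ * X]mulr_natl.
  by move/eqP; rewrite !mulf_eq0 (negPf F2) => /eqP.
have := qe i j; rewrite !B0 addr0 add0r -mulr2n -[X in X = _]mulr_natl.
by move/eqP; rewrite mulf_eq0 (negPf F2) => /eqP.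
Qed.

(** Gram-Schmidt: move an anisotropic vector to the first place of the basis,
clear the rest of the first row and column of the Gram matrix, and go on with
the orthogonal complement. *)
Lemma congruent_diag (n : nat) (B : 'M[F]_n) : B^T = B ->
  exists U c, U \in unitmx /\ U *m B *m U^T = diag_mx c.
Proof.
elim: n => [|n IHn] in B * => B_sym.
  by exists 1%:M, 0; rewrite unitmx1 [LHS]flatmx0 [RHS]flatmx0.
have [->|B_neq0] := eqVneq B 0.
  exists 1%:M, 0; rewrite unitmx1 mulmx0 mul0mx; split=> //.
  by apply/matrixP => i j; rewrite !mxE mul0rn.
have [v qv] := exists_anisotropic B_sym B_neq0.
(* The invertible right factor of the rank decomposition of v is a basis whose
   first vector is collinear to v. *)
pose N := row_ebase v; have Nu : N \in unitmx := row_ebase_unit v.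
have [B' B'N] : exists B' : 'M_(1 + n), N *m B *m N^T = B'.
  by exists (N *m B *m N^T).
have B'_sym : B'^T = B' by rewrite -B'N !trmx_mul trmxK B_sym mulmxA.
have B'00 : B' 0 0 != 0.
  apply: contraNneq qv => B'00.
  rewrite -(mulmx_ebase v) -/N; set u := _ *m pid_mx _.
  have -> : u = u 0 0 *: 'e_0.
    apply/rowP => j; rewrite !mxE !big_ord1 !mxE /=.
    by rewrite -mulrA -natrM mulnb andbC eq_sym.
  have scale_e0 (k : F) (X : 'M[F]_n.+1) :
      ((k *: 'e_0 : 'rV_n.+1) *m X *m (k *: 'e_0 : 'rV_n.+1)^T) 0 0
        = k * (k * X 0 0).
    rewrite -!scalemxAl linearZ /= -scalemxAr.
    by rewrite [LHS]mxE [X in _ * X]mxE delta_form_mx.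
  rewrite trmx_mul !mulmxA -(mulmxA _ N B) -(mulmxA _ (N *m B)) scale_e0 B'N.
  by rewrite [X in _ * (_ * X)]B'00 !mulr0.
pose a := ulsubmx B'; pose b := ursubmx B'.
have aE : a = (B' 0 0)%:M.
  apply/matrixP => i j; rewrite !ord1 !mxE eqxx mulr1n.
  congr (B' _ _); exact: val_inj.
have B'E : B' = block_mx a b b^T (drsubmx B').
  by rewrite -[LHS]submxK trmx_ursub B'_sym.
pose k := (B' 0 0)^-1; pose L : 'M_(1 + n) := block_mx 1%:M 0 (- k *: b^T) 1%:M.
pose B1 := drsubmx B' - k *: (b^T *m b).
have B1_sym : B1^T = B1.
  by rewrite linearB linearZ /= trmx_mul trmxK trmx_drsub B'_sym.
have LB : L *m B' *m L^T = block_mx a 0 0 B1.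
  have ka : - k *: b^T *m a = - b^T.
    by rewrite aE mul_mx_scalar scalerA mulrN mulfV // scaleN1r.
  have ak : a *m (- k *: b) = - b.
    by rewrite aE mul_scalar_mx scalerA mulrN mulfV // scaleN1r.
  rewrite {1}B'E tr_block_mx !mulmx_block linearZ /= trmxK trmx0 !trmx1.
  rewrite !mul1mx !mul0mx !mulmx0 !mulmx1 !addr0 ka ak !addNr mul0mx add0r.
  by rewrite -scalemxAl scaleNr addrC.
have [U1 [c1 [U1u U1B]]] := IHn _ B1_sym.
pose M : 'M_(1 + n) := block_mx 1%:M 0 0 U1.
have Mu : M \in unitmx by rewrite unitmxE det_ublock det1 mul1r -unitmxE.
have Lu : L \in unitmx by rewrite unitmxE det_lblock !det1 mulr1 unitr1.
exists (M *m L *m N), (row_mx a c1); split.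
  by rewrite !unitmx_mul Mu Lu.
have -> : M *m L *m N *m B *m (M *m L *m N)^T = M *m (L *m B' *m L^T) *m M^T.
  by rewrite -B'N !trmx_mul !mulmxA.
rewrite LB tr_block_mx !trmx0 trmx1 !mulmx_block.
rewrite !mul1mx !mul0mx !mulmx0 !addr0 !add0r mulmx1 U1B.
rewrite [RHS](diag_mx_row a c1).
have <- : a = diag_mx a; last by rewrite !mul0mx.
by apply/matrixP => i j; rewrite !ord1 [RHS]mxE mulr1n.
Qed.

End CongruenceDiagonalization.

Section GenericTensorExists.
Variable K : closedFieldType.

(** An algebraically closed field is infinite, by Euclid's argument: a root of
1 + (X - z_1)...(X - z_k) differs from all the z_i. *)
Lemma exists_uniq_nonzero (n : nat) :
  exists s : seq K, [/\ uniq s, size s = n & 0 \notin s].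
Proof.
elim: n => [|n [s [Us sz_s s0]]]; first by exists [::].
pose p : {poly K} := \prod_(z <- 0 :: s) ('X - z%:P) + 1.
have p_size : size p = n.+2.
  by rewrite size_polyDl ?size_poly1 size_prod_XsubC /= sz_s.
have /closed_rootP[x px] : size p != 1 by rewrite p_size.
have : x \notin 0 :: s.
  apply: contraL px => xs; rewrite /p (big_rem x) //= rootE !hornerE.
  by rewrite subrr mul0r add0r oner_eq0.
rewrite inE negb_or => /andP[x_neq0 xs]; exists (x :: s).
by rewrite /= xs Us sz_s inE negb_or eq_sym x_neq0 s0.
Qed.

Lemma exists_distinct_squares (n : nat) :
  exists l : 'I_n -> K, (forall i, l i != 0) /\ injective (fun i => l i ^+ 2).
Proof.
have [s [Us sz_s s0]] := exists_uniq_nonzero n.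
have /fin_all_exists[l lE] : forall i : 'I_n, exists x : K, x ^+ 2 = s`_i.
  move=> i.
  have /closed_rootP[x] : size ('X^2 - (s`_i)%:P) != 1 by rewrite size_XnsubC.
  by rewrite rootE !hornerE subr_eq0 => /eqP ?; exists x.
exists l; split=> [i|i j].
  apply: contraNneq s0 => li0; have <- : s`_i = 0 by rewrite -lE li0 expr0n.
  by rewrite mem_nth ?sz_s.
by rewrite !lE => /eqP; rewrite nth_uniq ?sz_s // => /eqP/val_inj.
Qed.

(** Let U be an orthogonal basis with Gram entries c_i.  For
A = U^T s U with s diagonal, S acts on the i-th vector of U as (c_i s_i)^2; so
take s_i = l_i / c_i where the l_i^2 are distinct. *)
Lemma exists_generic_tensor (n : nat) (B : 'M[K]_n) : 2%:R != 0 :> K ->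
  B^T = B -> B \in unitmx ->
  exists A, A \in unitmx /\ trace_disc (B *m A *m B *m A^T) != 0.
Proof.
move=> K2 B_sym Bu; have [U [c [Uu UB]]] := congruent_diag K2 B_sym.
have UTu : U^T \in unitmx by rewrite unitmx_tr.
have [l [l_neq0 linj]] := exists_distinct_squares n.
have c_neq0 i : c 0 i != 0.
  have : diag_mx c \in unitmx by rewrite -UB !unitmx_mul Uu Bu.
  by rewrite unitmxE det_diag unitfE => /prodf_neq0/(_ i isT).
pose s := \row_i (l i / c 0 i).
have s_unit : diag_mx s \in unitmx.
  rewrite unitmxE det_diag unitfE; apply/prodf_neq0 => i _.
  by rewrite mxE mulf_neq0 ?invr_eq0.
exists (U^T *m diag_mx s *m U); split; first by rewrite !unitmx_mul UTu s_unit.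
apply/(@trace_disc_neq0 _ _ _ U (\row_i (l i ^+ 2)) Uu); last first.
  by move=> i j; rewrite !mxE => /linj.
have csE : diag_mx c *m diag_mx s = diag_mx (\row_i l i).
  rewrite mulmx_diag; congr diag_mx; apply/rowP => i.
  by rewrite !mxE mulrCA mulfV ?mulr1.
rewrite !trmx_mul trmxK tr_diag_mx !mulmxA UB csE.
rewrite -(mulmxA _ U) -(mulmxA _ (U *m B)).
rewrite UB -(mulmxA _ (diag_mx c)) csE mulmx_diag; congr (diag_mx _ *m _).
by apply/rowP => i; rewrite !mxE.
Qed.

End GenericTensorExists.

(** * Elementary abelian groups of endomorphisms *)

(** The kernel of phi has a complement in D, because D is elementary abelian;
phi is injective on it and has the same image as on D. *)
Lemma elementary_abelian_image (p : nat) (K : fieldType) (W : vectType K)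
    (gT : finGroupType) (D : {group gT}) (phi : gT -> 'End(W))
    (H : 'End(W) -> Prop) :
  p.-abelem%g D -> phi 1%g = \1%VF ->
  {in D &, forall x y, phi (x * y)%g = (phi x \o phi y)%VF} ->
  (forall h, H h <-> (exists2 x, x \in D & h = phi x)) ->
  (exists2 x, x \in D & phi x != \1%VF) ->
  finite_nontrivial_elementary_abelian p H.
Proof.
move=> abelD phi1 phiM HE [x0 Dx0 phi_x0].
pose N := [set x in D | phi x == \1%VF].
have N_group : group_set N.
  apply/group_setP; split=> [|x y]; first by rewrite inE group1 phi1 eqxx.
  rewrite !inE => /andP[Dx /eqP x1] /andP[Dy /eqP y1].
  by rewrite groupM // phiM // x1 y1 comp_lfun1l eqxx.
have sND : Group N_group \subset D.
  by apply/subsetP => x; rewrite inE => /andP[].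
have /splitsP[E /complP[tiNE NE]] := abelem_splits abelD sND.
have sED : {subset E <= D}.
  by apply/subsetP; rewrite -NE mulG_subr.
exists gT, E, phi; split.
- move=> x y Ex Ey xy; apply/eqP; rewrite eq_mulgV1.
  suff : (x * y^-1)%g \in (Group N_group :&: E)%g by rewrite tiNE inE.
  rewrite inE [(x * y^-1)%g \in E]groupM ?groupV // andbT inE.
  rewrite groupM ?groupV ?sED //= phiM ?groupV ?sED // xy.
  by rewrite -phiM ?groupV ?sED // mulgV phi1.
- move=> h; split=> [/HE[x]|[x Ex ->]].
    rewrite -NE => /mulsgP[u v]; rewrite inE => /andP[Du /eqP u1] Ev -> ->.
    by exists v => //; rewrite phiM ?(sED v) // u1 comp_lfun1l.
  by apply/HE; exists x; rewrite ?sED.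
- by move=> x y Ex Ey; rewrite phiM ?sED.
- exact: abelemS (introT subsetP sED) abelD.
apply: contraNneq phi_x0 => E1; move: Dx0; rewrite -NE E1 mulg1 inE.
by case/andP.
Qed.

Section SignGroup.
Variables (F : fieldType) (n : nat).

Definition det1_signs : {set 'rV[bool]_n} := [set x | \det (signmx F x) == 1].

Lemma det1_signs_group : group_set det1_signs.
Proof.
apply/group_setP; split=> [|x y]; first by rewrite inE [signmx _ _]signmx0 det1.
rewrite !inE [signmx _ (x * y)%g]signmxD det_mulmx => /eqP-> /eqP->.
by rewrite mul1r.
Qed.

Canonical det1_signs_Group := Group det1_signs_group.

Lemma det1_signs_abelem : (2.-abelem det1_signs)%g.
Proof.
rewrite abelemE //; apply/andP; split.
  by apply/centsP => x _ y _; apply: addrC.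
apply/exponentP => x _; apply/rowP => i; rewrite !mxE.
by case: (x 0 i).
Qed.

(** Change the first two signs only.  A third index is necessary, because
determinant 1 forces the two signs to agree when n = 2. *)
Lemma exists_mixed_signs : (2 < n)%N ->
  exists x i j, [/\ x \in det1_signs, x 0 i = true & x 0 j = false].
Proof.
move=> n_gt2; have n_gt0 : (0 < n)%N by apply: leq_trans n_gt2.
have n_gt1 : (1 < n)%N by apply: leq_trans n_gt2.
pose i0 := Ordinal n_gt0; pose i1 := Ordinal n_gt1.
exists (\row_i (val i < 2)%N), i0, (Ordinal n_gt2); split; rewrite ?mxE //.
rewrite inE det_diag (bigD1 i0) // (bigD1 i1) //= big1 ?mulr1 => [|i].
  by rewrite !mxE /= expr1 mulrNN mulr1.
rewrite !mxE => /andP[]; rewrite -!val_eqE /=.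
by case: (val i) => [|[|m]].
Qed.

End SignGroup.

(** * Coordinates on the tensor product and on the quadratic space *)

Section TensorCoordinates.
Variables (K : fieldType) (V W : vectType K) (t : {bilinear V -> V -> W}).
Hypothesis tP : is_tensor_product t.
Local Notation n := (\dim {:V}).
Local Notation e := (vbasis {:V}).
Local Notation rV := (passmx.rVof e).

Lemma outerE (u v : V) : outer u v = (rV u)^T *m rV v.
Proof. by apply/matrixP => i j; rewrite !mxE big_ord1 !mxE. Qed.

(** W and the space of matrices are both tensor products of V with itself, and
objects with the same universal property are isomorphic. *)
Lemma tensor_coordinates :
  exists (Phi : 'Hom(W, 'M[K]_n)) (Psi : 'Hom('M[K]_n, W)),
    [/\ forall u v, Phi (t u v) = (rV u)^T *m rV v,
        cancel Phi Psi & cancel Psi Phi].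
Proof.
have uniq_id (X : vectType K) (b : {bilinear V -> V -> X}) (f : 'End(X)) :
    is_tensor_product b -> (forall u v, f (b u v) = b u v) -> forall x, f x = x.
  move=> bP fb x; have [g [_ g_uniq]] := bP _ b.
  rewrite -(g_uniq f fb) (g_uniq \1%VF) ?id_lfunE // => u v.
  by rewrite id_lfunE.
have oP := @outer_tensor_product K V V.
have [Phi [PhiE _]] := tP (@outer K V V : {bilinear V -> V -> 'M[K]_(n, n)}).
have [Psi [PsiE _]] := oP _ t.
exists Phi, Psi; split=> [u v|w|M].
- exact: etrans (PhiE u v) (outerE u v).
- rewrite -[RHS](uniq_id _ _ (Psi \o Phi)%VF tP) ?lfunE // => u v.
  by rewrite lfunE /= PhiE PsiE.
- rewrite -[RHS](uniq_id _ _ (Phi \o Psi)%VF oP) ?lfunE // => u v.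
  by rewrite lfunE /= PsiE PhiE.
Qed.

(** Transport to matrices, which are spanned by the tensor products of basis
vectors. *)
Lemma tensor_ext (X : vectType K) (f g : 'Hom(W, X)) :
  (forall u v, f (t u v) = g (t u v)) -> f = g.
Proof.
move=> fg; have [Phi [Psi [PhiE PhiK PsiK]]] := tensor_coordinates.
apply/lfunP => w; rewrite -(PhiK w) (matrix_sum_delta (Phi w)).
rewrite !linear_sum; apply: eq_bigr => i _.
rewrite !linear_sum; apply: eq_bigr => j _; rewrite !linearZ /=.
suff -> : Psi (delta_mx i j) = t e`_i e`_j by rewrite fg.
rewrite -(PhiK (t _ _)) PhiE !(passmx.rVofE (vbasisP _)) trmx_delta.
by rewrite mul_delta_mx.
Qed.

End TensorCoordinates.

Section GramMatrix.
Variables (K : fieldType) (V : vectType K) (Q : V -> K).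
Hypothesis QQ : quadratic_form Q.
Local Notation n := (\dim {:V}).
Local Notation e := (vbasis {:V}).
Local Notation rV := (passmx.rVof e).

Definition gram : 'M[K]_n := \matrix_(i, j) polar Q e`_i e`_j.

Lemma polarC u v : polar Q u v = polar Q v u.
Proof. by rewrite /polar (addrC u) addrAC. Qed.

Lemma polar_gram u v : polar Q u v = (rV u *m gram *m (rV v)^T) 0 0.
Proof.
pose fl z : {scalar V} := HB.pack (polar Q ^~ z)
  (GRing.isLinear.Build K V K *%R (polar Q ^~ z) (polar_linearl QQ z)).
pose fr z : {scalar V} := HB.pack (polar Q z)
  (GRing.isLinear.Build K V K *%R (polar Q z) (polar_linearr QQ z)).
rewrite -[LHS]/(fl v u) {1}(coord_vbasis (memvf u)) linear_sum.
rewrite -mulmxA !mxE; apply: eq_bigr => i _; rewrite linearZ /= !mxE.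
congr (_ * _); rewrite -[LHS]/(fr _ v) {1}(coord_vbasis (memvf v)) linear_sum.
by apply: eq_bigr => j _; rewrite linearZ /= !mxE mulrC.
Qed.

Lemma polar_diag v : polar Q v v = 2%:R * Q v.
Proof.
rewrite /polar -mulr2n -scaler_nat (quadraticZ QQ) -addrA -opprD -mulr2n.
rewrite -[Q v *+ 2]mulr_natl -mulrBl expr2; congr (_ * _).
by rewrite -[X in _ - X]mulr1 -mulrBr -[X in X - _]/(1 + 1) addrK mulr1.
Qed.

Lemma gram_sym : gram^T = gram.
Proof. by apply/matrixP => i j; rewrite !mxE polarC. Qed.

Lemma gram_unit : nondegenerate_quadratic Q -> gram \in unitmx.
Proof.
move=> ndQ; rewrite -row_free_unit; apply: inj_row_free => x xB.
have xE : x = rV (passmx.vecof e x) by rewrite passmx.vecofK ?vbasisP.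
apply/eqP; rewrite xE passmx.rVof_eq0 ?vbasisP //; apply/eqP/ndQ => u.
by rewrite polar_gram -xE -gram_sym -mulmxA -trmx_mul xB trmx0 mulmx0 mxE.
Qed.

(** Since 2 is invertible, Q is determined by its polar form. *)
Lemma isometryP (g : 'End(V)) (G := passmx.mxof e e g) : 2%:R != 0 :> K ->
  (forall v, Q (g v) = Q v) <-> G *m gram *m G^T = gram.
Proof.
move=> K2; have polar_g u v :
    polar Q (g u) (g v) = (rV u *m (G *m gram *m G^T) *m (rV v)^T) 0 0.
  by rewrite polar_gram !(passmx.rVof_app _ (vbasisP _)) trmx_mul !mulmxA.
split=> [gQ|GB v]; last first.
  by apply: (mulfI K2); rewrite -!polar_diag polar_g GB -polar_gram.
apply/matrixP => i j; have := polar_g e`_i e`_j.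
rewrite {1}/polar -linearD !gQ -/(polar _ _ _) polar_gram.
by rewrite !(passmx.rVofE (vbasisP _)) !delta_form_mx.
Qed.

End GramMatrix.

Section Twist.
Variables (K : fieldType) (W : vectType K) (n : nat).
Variables (Phi : 'Hom(W, 'M[K]_n)) (Psi : 'Hom('M[K]_n, W)).
Hypotheses (PhiK : cancel Phi Psi) (PsiK : cancel Psi Phi).

(** The action of a pair of matrices on V (x) V, read through the coordinates
Phi.  Vectors are rows, so composition is reversed in [twistM]. *)
Definition twist (G1 G2 : 'M[K]_n) : 'End(W) :=
  (Psi \o linfun (mulmxr G2 \o mulmx G1^T) \o Phi)%VF.

Lemma twistE G1 G2 w : Phi (twist G1 G2 w) = G1^T *m Phi w *m G2.
Proof. by rewrite comp_lfunE comp_lfunE lfunE /= PsiK. Qed.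

Lemma twist1 : twist 1%:M 1%:M = \1%VF.
Proof.
apply/lfunP => w; apply: (can_inj PhiK).
by rewrite twistE trmx1 mul1mx mulmx1 id_lfunE.
Qed.

Lemma twistM G1 G2 H1 H2 :
  twist (G1 *m H1) (G2 *m H2) = (twist H1 H2 \o twist G1 G2)%VF.
Proof.
apply/lfunP => w; apply: (can_inj PhiK).
by rewrite comp_lfunE !twistE trmx_mul !mulmxA.
Qed.

End Twist.

Section GenericMatrix.
Variables (K : fieldType) (W : vectType K) (n : nat) (Phi : 'Hom(W, 'M[K]_n)).

(** The entries are linear forms in the coordinates of a generic vector of W. *)
Definition generic_mx : 'M[{mpoly K[\dim {:W}]}]_n :=
  \matrix_(i, j) \sum_(k < \dim {:W}) (Phi (vbasis {:W})`_k i j)%:MP * 'X_k.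

Lemma meval_generic_mx w :
  map_mx (meval (fun k => coord (vbasis {:W}) k w)) generic_mx = Phi w.
Proof.
apply/matrixP => i j; rewrite !mxE rmorph_sum.
rewrite {2}(coord_vbasis (memvf w)) linear_sum summxE; apply: eq_bigr => k _.
by rewrite rmorphM /= mevalC mevalXU linearZ mxE mulrC.
Qed.

End GenericMatrix.

(** * The generic stabilizer *)

Theorem corollary12 (K : closedFieldType) (V : vectType K) (Q : V -> K)
    (W : vectType K) (t : {bilinear V -> V -> W}%R) :
  2%N \notin [pchar K]%R ->
  (2 < \dim {:V})%N ->
  quadratic_form Q ->
  nondegenerate_quadratic Q ->
  is_tensor_product t ->
  generic_stabilizer (SO_tensor_SO Q t)
    (@finite_nontrivial_elementary_abelian 2 K W).
Proof.
move=> char2 dimV QQ ndQ tP.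
have K2 : 2%:R != 0 :> K by apply: contra char2 => K20; rewrite inE K20.
have [Phi [Psi [PhiE PhiK PsiK]]] := tensor_coordinates tP.
pose e := vbasis {:V}; have eP : basis_of {:V} e := vbasisP _.
pose B := gram Q; have B_sym : B^T = B := gram_sym Q.
have Bu : B \in unitmx := gram_unit QQ ndQ.
pose X := generic_mx Phi; pose BX := map_mx (@mpolyC (\dim {:W}) K) B.
pose f := \det X * trace_disc (BX *m X *m BX *m X^T).
have fE w : poly_eval f w
    = \det (Phi w) * trace_disc (B *m Phi w *m B *m (Phi w)^T).
  rewrite /poly_eval rmorphM /= -det_map_mx -trace_disc_map !map_mxM -map_trmx.
  rewrite meval_generic_mx.
  have -> // : map_mx (meval (fun k => coord (vbasis {:W}) k w)) BX = B.
  by apply/matrixP => i j; rewrite !mxE /= mevalC.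
exists (fun w => poly_eval f w != 0); split.
- by exists (eq f) => w; split=> [fw|[_ <-]] //; exists f.
- have [A [Au A_disc]] := exists_generic_tensor K2 B_sym Bu.
  by exists (Psi A); rewrite fE PsiK mulf_neq0 // -unitfE -unitmxE.
move=> w; rewrite fE mulf_eq0 negb_or -unitfE -unitmxE => /andP[Au A_disc].
have [U [U' [c [d [[Uu U'u AE] UB UB' cd_inj]]]]] :=
  orthogonal_normal_form B_sym Au A_disc.
pose phi x := twist Phi Psi (sign_in U x) (sign_in U' x).
apply: (@elementary_abelian_image _ _ _ _ (det1_signs_Group K _) phi).
- exact: det1_signs_abelem.
- by rewrite /phi !sign_in0 // twist1.
- move=> x y _ _; have -> : (x * y)%g = y + x by exact: addrC.
  by rewrite /phi !sign_inD // twistM.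
- move=> h; split=> [[[g1 [g2 [[g1Q g1det] [g2Q g2det] hE]]] hw]|[x Dx ->]].
    pose G1 := passmx.mxof e e g1; pose G2 := passmx.mxof e e g2.
    have {}hE : h = twist Phi Psi G1 G2.
      apply: (tensor_ext tP) => u v; apply: (can_inj PhiK).
      rewrite hE (twistE PsiK) !PhiE !(passmx.rVof_app _ eP) trmx_mul.
      by rewrite !mulmxA.
    have G1B := (isometryP QQ g1 K2).1 g1Q.
    have G2B := (isometryP QQ g2 K2).1 g2Q.
    have := congr1 Phi hw; rewrite hE (twistE PsiK) AE => G12.
    have [x [G1E G2E]] :=
      stabilizer_normal_form Bu Uu U'u UB UB' cd_inj G1B G2B G12.
    exists x; last by rewrite /phi -G1E -G2E.
    by rewrite inE -(det_sign_in x Uu) -G1E; apply/eqP.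
  have SO_sign (P : 'M_(\dim {:V})) g : P \in unitmx ->
      P *m B *m P^T = diag_mx g ->
      special_orthogonal Q (passmx.hommx e e (sign_in P x)).
    move=> Pu PB; split.
      apply/(isometryP QQ _ K2); rewrite passmx.hommxK //.
      exact: sign_in_isometry Pu PB.
    rewrite /lfun_det passmx.hommxK // det_sign_in //.
    by move: Dx; rewrite inE => /eqP.
  split; last first.
    by apply: (can_inj PhiK); rewrite (twistE PsiK) AE sign_in_stabilizes.
  exists (passmx.hommx e e (sign_in U x)), (passmx.hommx e e (sign_in U' x)).
  split=> [||u v]; [exact: SO_sign UB | exact: SO_sign UB' |].
  apply: (can_inj PhiK); rewrite (twistE PsiK) !PhiE -!(passmx.rVof_mul eP eP).
  by rewrite [in RHS]trmx_mul !mulmxA.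
(* These signs negate the tensor product of the i-th vector of U and the j-th
   vector of U', where x_i is a minus sign and x_j is a plus sign. *)
have [x [i [j [Dx xi xj]]]] := exists_mixed_signs K dimV.
exists x => //; apply: contra K2 => /eqP phi1.
have U_Tu : U^T \in unitmx by rewrite unitmx_tr.
pose uu' := Psi (U^T *m delta_mx i j *m U').
have := congr1 (fun g : 'End(W) => Phi (g uu')) phi1.
rewrite (twistE PsiK) id_lfunE PsiK sign_in_act //.
move/(can_inj (mulmxK U'u))/(can_inj (mulKmx U_Tu))/matrixP/(_ i j)/eqP.
rewrite mul_mx_diag mul_diag_mx !mxE xi xj !eqxx /= expr0 expr1 !mulr1.
by rewrite eq_sym -addr_eq0.
Qed.
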